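(* Let $N\ge 2$, $k=\frac{N(N-1)}{2}$, and consider an $N$-Higgs-doublet potential written in bilinear form $$V=M_0K_0+M_aK_a+\Lambda_0K_0^2+L_aK_0K_a+\Lambda_{ab}K_aK_b$$ (summation over $a,b=1,\dots,N^2-1$), with $M_0,\Lambda_0\in\mathbb{R}$, $L,M\in\mathbb{R}^{N^2-1}$ and $\Lambda$ a real symmetric $(N^2-1)\times(N^2-1)$ matrix. Then $V$ admits a $CP2$ symmetry if and only if the following two conditions both hold: (i) there exist $k$ linearly independent eigenvectors $v_1,\dots,v_k\in\mathbb{R}^{N^2-1}$ of $\Lambda$ such that, writing $V_a=\sum_{i=1}^{N^2-1}(v_a)_i\lambda_i$, the real linear span $\mathcal{W}=\mathrm{span}_{\mathbb{R}}\{V_1,\dots,V_k\}$ forms a basis of (a Hermitian-matrix realization of) the defining representation of $\mathfrak{so}(N)$, i.e. $\mathcal{W}$ is closed under $(A,B)\mapsto -i[A,B]$ and there exists an invertible $S\in GL(N,\mathbb{C})$ with $S\,\mathcal{W}\,S^{-1}=\mathrm{span}_{\mathbb{R}}\{\lambda_1,\dots,\lambda_k\}=\{iA: A \text{ a real antisymmetric } N\times N \text{ matrix}\}$; (ii) $L\cdot v_a=M\cdot v_a=0$ for all $a\in\{1,\dots,k\}$.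
   Context: The model has $N$ Higgs $\mathsf{SU}(2)$ doublets $\Phi_1,\dots,\Phi_N$. The bilinears are $K_0=\Phi_i^\dagger\Phi_i$ and $K_a=\Phi_i^\dagger(\lambda_a)_{ij}\Phi_j$, $a=1,\dots,N^2-1$, where $\lambda_a$ are the generalized Gell-Mann matrices: Hermitian traceless $N\times N$ matrices with $\mathrm{Tr}(\lambda_a\lambda_b)=2\delta_{ab}$, $[\lambda_a,\lambda_b]=2if_{abc}\lambda_c$, ordered so that $\lambda_1,\dots,\lambda_k$ are the antisymmetric (purely imaginary) ones and $\lambda_{k+1},\dots,\lambda_{N^2-1}$ are the symmetric (real) ones. A change of doublet basis $\Phi_i\to U_{ij}\Phi_j$, $U\in\mathsf{SU}(N)$, leaves $K_0$ invariant and sends $K_a\to R_{ab}(U)K_b$ with $R_{ab}(U)=\frac12\mathrm{Tr}(U^\dagger\lambda_aU\lambda_b)$; correspondingly $L\to R(U)L$, $M\to R(U)M$, $\Lambda\to R(U)\Lambda R(U)^T$. A general $CP$ transformation is $\Phi_i(\vec x,t)\to V_{ij}\Phi_j^*(-\vec x,t)$ with $V\in\mathsf{U}(N)$; the potential admits a $CP2$ symmetry if it is invariant under such a transformation which is of order 2 (applying it twice gives the identity). It is known that a $CP2$ symmetry exists if and only if there is a doublet basis in which all coefficients of the potential are real, i.e. a basis in which $\Lambda_{ab}=0$ whenever $a\le k<b$ (so $\Lambda$ is block diagonal with respect to antisymmetric/symmetric generators) and $L_a=M_a=0$ for all $a\le k$. *)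

(* Defs.v *)
From HB Require Import structures.
From mathcomp Require Import all_boot all_order all_algebra.
From mathcomp Require Import reals.
From mathcomp Require Export complex.
Set Implicit Arguments. Unset Strict Implicit. Unset Printing Implicit Defensive.
Import Order.TTheory GRing.Theory Num.Theory.
Local Open Scope ring_scope.

Section NHDM.
Variable R : realType.
Local Notation C := (R[i]).

Definition rC (x : R) : C := Complex x 0.
Definition cI : C := Complex 0 1.
Definition cconj (z : C) : C := conjc z.

Definition adjmx (m n : nat) (A : 'M[C]_(m, n)) : 'M[C]_(n, m) := (map_mx cconj A)^T.

Definition nk (N : nat) : nat := (N * (N - 1)) %/ 2.
Definition ng (N : nat) : nat := (N ^ 2 - 1)%N.

Definition gell_mann_basis (N : nat) (lam : 'I_(ng N) -> 'M[C]_N) : Prop :=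
  [/\ forall a, adjmx (lam a) = lam a,
      forall a, \tr (lam a) = 0,
      forall a b, \tr (lam a *m lam b) = (a == b)%:R *+ 2,
      forall a : 'I_(ng N), (a < nk N)%N -> map_mx cconj (lam a) = - lam a
    & forall a : 'I_(ng N), (nk N <= a)%N -> map_mx cconj (lam a) = lam a].

(* Fields: Phi : 'M_(N,2), row i = the SU(2) doublet Phi_i. *)
Definition K0 (N : nat) (Phi : 'M[C]_(N, 2)) : C :=
  \sum_(i < N) \sum_(al < 2) cconj (Phi i al) * Phi i al.

Definition Kbil (N : nat) (lama : 'M[C]_N) (Phi : 'M[C]_(N, 2)) : C :=
  \sum_(i < N) \sum_(j < N) \sum_(al < 2) cconj (Phi i al) * lama i j * Phi j al.

Definition potential (N : nat) (lam : 'I_(ng N) -> 'M[C]_N)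
    (M0 Lam0 : R) (M L : 'I_(ng N) -> R) (Lam : 'M[R]_(ng N))
    (Phi : 'M[C]_(N, 2)) : C :=
  rC M0 * K0 Phi
  + \sum_a rC (M a) * Kbil (lam a) Phi
  + rC Lam0 * K0 Phi ^+ 2
  + \sum_a rC (L a) * K0 Phi * Kbil (lam a) Phi
  + \sum_a \sum_b rC (Lam a b) * Kbil (lam a) Phi * Kbil (lam b) Phi.

(* General CP transformation Phi_i -> V_ij Phi_j^*, V unitary; it is of order 2
   iff V V^* = 1. CP2 symmetry: invariance of the potential under such a map. *)
Definition has_CP2 (N : nat) (lam : 'I_(ng N) -> 'M[C]_N)
    (M0 Lam0 : R) (M L : 'I_(ng N) -> R) (Lam : 'M[R]_(ng N)) : Prop :=
  exists U : 'M[C]_N,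
    [/\ U *m adjmx U = 1%:M,
        U *m map_mx cconj U = 1%:M
      & forall Phi : 'M[C]_(N, 2),
          potential lam M0 Lam0 M L Lam (U *m map_mx cconj Phi)
          = potential lam M0 Lam0 M L Lam Phi].

Definition Vgen (N : nat) (lam : 'I_(ng N) -> 'M[C]_N) (v : 'cV[R]_(ng N)) : 'M[C]_N :=
  \sum_i rC (v i 0) *: lam i.

Definition in_W (N : nat) (lam : 'I_(ng N) -> 'M[C]_N)
    (v : 'I_(nk N) -> 'cV[R]_(ng N)) (X : 'M[C]_N) : Prop :=
  exists c : 'I_(nk N) -> R, X = \sum_a rC (c a) *: Vgen lam (v a).

Definition i_antisym (N : nat) (Y : 'M[C]_N) : Prop :=
  exists A : 'M[R]_N, A^T = - A /\ Y = cI *: map_mx rC A.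

Definition eigvec (n : nat) (Lam : 'M[R]_n) (v : 'cV[R]_n) : Prop :=
  v != 0 /\ exists mu : R, Lam *m v = mu *: v.

Definition cond_i (N : nat) (lam : 'I_(ng N) -> 'M[C]_N) (Lam : 'M[R]_(ng N))
    (v : 'I_(nk N) -> 'cV[R]_(ng N)) : Prop :=
  [/\ row_free (\matrix_(a < nk N, i < ng N) v a i 0),
      forall a, eigvec Lam (v a),
      forall A B, in_W lam v A -> in_W lam v B ->
                  in_W lam v (- cI *: (A *m B - B *m A))
    & exists S : 'M[C]_N,
        [/\ S \in unitmx,
            forall X, in_W lam v X -> i_antisym (S *m X *m invmx S)
          & forall Y, i_antisym Y ->
              exists X, in_W lam v X /\ Y = S *m X *m invmx S]].

Definition cond_ii (N : nat) (M L : 'I_(ng N) -> R)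
    (v : 'I_(nk N) -> 'cV[R]_(ng N)) : Prop :=
  forall a, \sum_i L i * v a i 0 = 0 /\ \sum_i M i * v a i 0 = 0.

End NHDM.

(* Main.v *)
Require Import Defs.
From HB Require Import structures.
From mathcomp Require Import all_boot all_order all_algebra.
From mathcomp Require Import reals complex.
From mathcomp Require Import spectral mxred ring.
Set Implicit Arguments. Unset Strict Implicit. Unset Printing Implicit Defensive.
Import GRing.Theory Num.Theory.
Local Open Scope ring_scope.
Local Open Scope sesquilinear_scope.

(** A unitary [U] defines a CP transformation of order 2 iff it is symmetric,
    and then [U = W W^T] with [W] unitary. In the doublet basis [W^dagger Phi]
    the transformation is complex conjugation, which transposes the bilinear
    matrix [Phi Phi^dagger] and thus changes the sign of exactly the [K_a] with
    [lam a] antisymmetric. In the original basis it reflects the vector of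
    bilinears along the space of coordinates of [W (i so(N)) W^dagger]. By
    polarization a potential determines its coefficients, so it is invariant
    iff this space is stable under [Lambda] and orthogonal to [L] and [M]. Being
    symmetric, [Lambda] is then diagonalizable on it, which yields the vectors
    [v_a]. Conversely, by polar decomposition, the similarity [S] between the
    span of the [V_a] and [i so(N)] may be taken unitary, and [W = S^dagger]. *)

Local Notation toC := (map_mx (real_complex _)).

(** * Unitary matrices and square roots *)

Section DiagonalIntertwining.
Variables (F : fieldType) (m n : nat) (f : F -> F).
Implicit Types (d : 'rV[F]_m) (e : 'rV[F]_n).

Lemma intertwine_diag_map d e (Z : 'M[F]_(m, n)) :
  diag_mx d *m Z = Z *m diag_mx e ->
  diag_mx (map_mx f d) *m Z = Z *m diag_mx (map_mx f e).
Proof.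
move=> /matrixP dZ; apply/matrixP=> i j; have := dZ i j.
rewrite !mul_mx_diag !mul_diag_mx !mxE.
have [->|Znz] := eqVneq (Z i j) 0; first by rewrite !mulr0 !mul0r.
by rewrite mulrC => /(mulfI Znz) ->; rewrite mulrC.
Qed.

(* Hence a function of a diagonalizable matrix does not depend on the
   diagonalization and commutes with whatever the matrix commutes with. *)
Lemma intertwine_conj_diag_map d e (P : 'M[F]_m) (Q : 'M[F]_n)
    (X : 'M[F]_(m, n)) :
  P \in unitmx -> Q \in unitmx ->
  invmx P *m diag_mx d *m P *m X = X *m (invmx Q *m diag_mx e *m Q) ->
  invmx P *m diag_mx (map_mx f d) *m P *m X =
  X *m (invmx Q *m diag_mx (map_mx f e) *m Q).
Proof.
move=> Pu Qu PXQ; pose Z := P *m X *m invmx Q.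
have /intertwine_diag_map : diag_mx d *m Z = Z *m diag_mx e.
  have := congr1 (fun Y => P *m Y *m invmx Q) PXQ.
  by rewrite !mulmxA mulmxV // mul1mx mulmxK.
move=> /(congr1 (fun Y => invmx P *m Y *m Q)).
by rewrite !mulmxA mulmxKV // mulVmx // mul1mx.
Qed.

End DiagonalIntertwining.

Section UnitaryMatrices.
Variable C : numClosedFieldType.
Implicit Types m n : nat.

Lemma trmxC_mul m n p (A : 'M[C]_(m, n)) (B : 'M[C]_(n, p)) :
  (A *m B)^t* = B^t* *m A^t*.
Proof. by rewrite trmx_mul map_mxM. Qed.

Lemma mul_trmxC_unitary n (W : 'M[C]_n) : W \is unitarymx -> W^t* *m W = 1%:M.
Proof. by move/unitarymxP/mulmx1C. Qed.

Lemma unitary_conj_mulP n (U : 'M[C]_n) : U \is unitarymx ->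
  U *m map_mx Num.conj U = 1%:M <-> U^T = U.
Proof.
move=> Uu; split=> [U2|Us]; last by rewrite -[in X in map_mx _ X]Us (unitarymxP Uu).
have : map_mx Num.conj U = U^t*.
  by rewrite -[LHS]mul1mx -(mul_trmxC_unitary Uu) -mulmxA U2 mulmx1.
by move/map_mx_inj.
Qed.

Lemma unitary_normalmx n (U : 'M[C]_n) : U \is unitarymx -> U \is normalmx.
Proof. by move=> Uu; apply/normalmxP; rewrite mul_trmxC_unitary ?(unitarymxP _). Qed.

Lemma mul_trmxC_normalmx n (S : 'M[C]_n) : S *m S^t* \is normalmx.
Proof. by apply/normalmxP; rewrite trmxC_mul trmxCK. Qed.

Lemma gram_CP m n (W : 'M[C]_n) (Phi : 'M[C]_(n, m))
    (Psi := W *m W^T *m map_mx Num.conj Phi) :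
  Psi *m Psi^t* = W *m (W^t* *m (Phi *m Phi^t*) *m W)^T *m W^t*.
Proof.
by rewrite /Psi !trmxC_mul !trmx_mul !map_trmx !trmxK !mulmxA map_mxCK.
Qed.

Lemma conj_unitaryK n (W X : 'M[C]_n) : W \is unitarymx ->
  W^t* *m (W *m X *m W^t*) *m W = X.
Proof. by move=> Wu; rewrite !mulmxA mulmxKtV // mul_trmxC_unitary // mul1mx. Qed.

Lemma conj_unitary_inj n (W : 'M[C]_n) : W \is unitarymx ->
  injective (fun X => W *m X *m W^t*).
Proof.
move=> Wu; apply: (can_inj (g := fun X => W^t* *m X *m W)) => X.
exact: conj_unitaryK.
Qed.

Lemma conj_unitaryKV n (W X : 'M[C]_n) : W \is unitarymx ->
  W *m (W^t* *m X *m W) *m W^t* = X.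
Proof. by move=> Wu; rewrite !mulmxA mulmxtVK // (unitarymxP Wu) mul1mx. Qed.

Lemma conj_unitaryM n (W X Y : 'M[C]_n) : W \is unitarymx ->
  W^t* *m (X *m Y) *m W = (W^t* *m X *m W) *m (W^t* *m Y *m W).
Proof. by move=> Wu; rewrite !mulmxA mulmxtVK. Qed.

Lemma diag_unitarymx n (d : 'rV[C]_n) :
  (diag_mx d \is unitarymx) = [forall i, `|d 0 i| == 1].
Proof.
have norm1 i : (`|d 0 i| == 1) = (d 0 i * (d 0 i)^* == 1).
  by rewrite -normCK sqrp_eq1.
apply/unitarymxP/forallP => [/matrixP dd i|dd].
  have := dd i i; rewrite tr_diag_mx map_diag_mx mulmx_diag !mxE eqxx mulr1n.
  by rewrite norm1 => ->.
rewrite tr_diag_mx map_diag_mx mulmx_diag -diag_const_mx; congr diag_mx.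
by apply/rowP=> i; rewrite !mxE; apply/eqP; rewrite -norm1.
Qed.

Definition sqrtmx n (A : 'M[C]_n) : 'M[C]_n :=
  invmx (spectralmx A) *m diag_mx (map_mx sqrtC (spectral_diag A)) *m spectralmx A.

Lemma sqrtmxK n (A : 'M[C]_n) : A \is normalmx -> sqrtmx A *m sqrtmx A = A.
Proof.
move=> /orthomx_spectralP {3}->; have Pu := spectral_unit A.
rewrite /sqrtmx !mulmxA mulmxK // -[_ *m diag_mx _ *m diag_mx _]mulmxA mulmx_diag.
congr (_ *m diag_mx _ *m _); apply/rowP=> i.
by rewrite !mxE -expr2 sqrtCK.
Qed.

Lemma comm_sqrtmx n (A X : 'M[C]_n) : A \is normalmx ->
  A *m X = X *m A -> sqrtmx A *m X = X *m sqrtmx A.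
Proof.
move=> /orthomx_spectralP {1 2}->.
by apply: intertwine_conj_diag_map; apply: spectral_unit.
Qed.

Lemma trmx_sqrtmx n (A : 'M[C]_n) : A \is normalmx ->
  A^T = A -> (sqrtmx A)^T = sqrtmx A.
Proof.
move=> /orthomx_spectralP; have Pu := spectral_unit A; move=> {1 2}-> As.
have trE (d : 'rV[C]_n) :
    (invmx (spectralmx A) *m diag_mx d *m spectralmx A)^T =
    invmx (invmx (spectralmx A))^T *m diag_mx d *m (invmx (spectralmx A))^T.
  by rewrite !trmx_mul tr_diag_mx trmx_inv invmxK mulmxA.
rewrite trE -[LHS]mulmx1 -[RHS]mul1mx.
apply: intertwine_conj_diag_map; rewrite ?unitmx_tr ?unitmx_inv //.
by rewrite mulmx1 mul1mx -trE.
Qed.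

Lemma spectral_diagE n (A : 'M[C]_n) : A \is normalmx ->
  diag_mx (spectral_diag A) = spectralmx A *m A *m (spectralmx A)^t*.
Proof.
have Pu := spectral_unit A.
move=> /orthomx_spectralP {3}->; rewrite -invmx_unitary ?spectral_unitarymx //.
by rewrite !mulmxA mulmxV // mul1mx mulmxK.
Qed.

Lemma sqrtmx_unitary n (U : 'M[C]_n) : U \is unitarymx -> sqrtmx U \is unitarymx.
Proof.
move=> Uu; have Pu := spectral_unitarymx U.
have : diag_mx (spectral_diag U) \is unitarymx.
  by rewrite spectral_diagE ?unitary_normalmx // !mul_unitarymx ?trmxC_unitary.
rewrite diag_unitarymx => /forallP d1.
rewrite /sqrtmx invmx_unitary // !mul_unitarymx ?trmxC_unitary // diag_unitarymx.
by apply/forallP=> i; rewrite mxE -sqrp_eq1 // -normrX sqrtCK.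
Qed.

Lemma trmxC_sqrtmx_gram n (S : 'M[C]_n) :
  (sqrtmx (S *m S^t*))^t* = sqrtmx (S *m S^t*).
Proof.
set G := S *m _; have Pu := spectral_unitarymx G.
have d_ge0 i : 0 <= spectral_diag G 0 i.
  have : diag_mx (spectral_diag G) = (spectralmx G *m S) *m (spectralmx G *m S)^t*.
    by rewrite spectral_diagE ?mul_trmxC_normalmx // trmxC_mul !mulmxA.
  move=> /matrixP/(_ i i); rewrite !mxE eqxx mulr1n => ->.
  by apply: sumr_ge0 => j _; rewrite !mxE mul_conjC_ge0.
rewrite /sqrtmx invmx_unitary // !trmxC_mul trmxCK tr_diag_mx map_diag_mx mulmxA.
congr (_ *m diag_mx _ *m _); apply/rowP=> i; rewrite !mxE.
by apply/CrealP; rewrite ger0_real // sqrtC_ge0.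
Qed.

Lemma symmetric_unitary_factor n (U : 'M[C]_n) : U \is unitarymx -> U^T = U ->
  exists2 W : 'M[C]_n, W \is unitarymx & U = W *m W^T.
Proof.
move=> Uu Us; have Un := unitary_normalmx Uu.
exists (sqrtmx U); first exact: sqrtmx_unitary.
by rewrite trmx_sqrtmx // sqrtmxK.
Qed.

(* The Hermitian factor of the polar decomposition of [S] commutes with every
   Hermitian [S X S^-1], hence can be dropped from the similarity. *)
Lemma unitary_similarity n (S : 'M[C]_n) : S \in unitmx ->
  exists2 W : 'M[C]_n, W \is unitarymx &
    forall X, X^t* = X -> (S *m X *m invmx S)^t* = S *m X *m invmx S ->
      W *m X *m W^t* = S *m X *m invmx S.
Proof.
move=> Su; pose H := sqrtmx (S *m S^t*).
have HH : H *m H = S *m S^t* by rewrite sqrtmxK ?mul_trmxC_normalmx.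
have Hu : H \in unitmx.
  have : S *m S^t* \in unitmx by rewrite unitmx_mul Su map_unitmx unitmx_tr.
  by rewrite -HH unitmx_mul => /andP[].
have Wu : invmx H *m S \is unitarymx.
  apply/unitarymxP; rewrite trmxC_mul -mulmxA (mulmxA S) -HH.
  rewrite -{3}[H]trmxC_sqrtmx_gram -/H -mulmxA mulKmx // -trmxC_mul mulVmx //.
  by rewrite trmx1 map_mx1.
exists (invmx H *m S) => // X Xh; move YE: (S *m X *m invmx S) => Y Yh.
have SX : S *m X = Y *m S by rewrite -YE mulmxKV.
have YH : H *m Y = Y *m H.
  apply: comm_sqrtmx; first exact: mul_trmxC_normalmx.
  by rewrite mulmxA -SX -!mulmxA -{1}Yh -trmxC_mul -SX trmxC_mul Xh.
rewrite -[_ *m S *m X]mulmxA SX -[Y in RHS](mulmxtVK _ Wu); congr (_ *m _).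
apply: (can_inj (mulKmx Hu)).
by rewrite !mulmxA mulmxV // mul1mx YH mulmxK.
Qed.

End UnitaryMatrices.

(** * Reflections and symmetric matrices *)

Section Reflection.
Variables (F : realFieldType) (k n : nat) (B : 'M[F]_(k, n)).
Hypothesis B_orthonormal : B *m B^T = 1%:M.

Let two_neq0 : 2%:R != 0 :> F. Proof. by rewrite pnatr_eq0. Qed.

Definition reflection : 'M[F]_n := 1%:M - 2%:R *: (B^T *m B).

Lemma trmx_reflection : reflection^T = reflection.
Proof. by rewrite linearB linearZ /= trmx1 trmx_mul trmxK. Qed.

Lemma mul_reflection m (A : 'M[F]_(m, n)) :
  A *m reflection = A - 2%:R *: (A *m B^T *m B).
Proof. by rewrite mulmxBr mulmx1 -scalemxAr mulmxA. Qed.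

Lemma reflectionK : reflection *m reflection = 1%:M.
Proof.
have reflB : reflection *m B^T = - B^T.
  rewrite mulmxBl mul1mx -scalemxAl -mulmxA B_orthonormal mulmx1.
  by rewrite scaler_nat mulr2n opprD addNKr.
by rewrite mul_reflection reflB mulNmx scalerN opprK subrK.
Qed.

Lemma reflection_fixP m (A : 'M[F]_(m, n)) :
  A *m reflection = A <-> A *m B^T = 0.
Proof.
rewrite mul_reflection; split=> [/eqP|->]; last by rewrite mul0mx scaler0 subr0.
rewrite -subr_eq0 addrAC subrr add0r oppr_eq0 scaler_eq0 (negPf two_neq0) /=.
by move=> /eqP AB; rewrite -[LHS]mulmx1 -B_orthonormal mulmxA AB mul0mx.
Qed.

Lemma reflection_oppP m (A : 'M[F]_(m, n)) :
  reflect (A *m reflection = - A) (A <= B)%MS.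
Proof.
rewrite mul_reflection; apply: (iffP submxP) => [[D ->]|eqA].
  rewrite -(mulmxA D) B_orthonormal mulmx1 scaler_nat mulr2n opprD.
  by rewrite addrA subrr add0r.
exists (A *m B^T); apply: (scalerI two_neq0); rewrite -[RHS](subKr A) eqA opprK.
by rewrite scaler_nat mulr2n.
Qed.

Lemma stablemx_projectorP (A : 'M[F]_n) : A^T = A ->
  B^T *m B *m A = A *m B^T *m B <-> stablemx B A.
Proof.
move=> As; split=> [comm|/submxP[D BD]].
  apply/submxP; exists (B *m A *m B^T).
  by rewrite -!mulmxA (mulmxA A) -comm !mulmxA B_orthonormal mul1mx.
have D_sym : D^T = D.
  have -> : D = B *m A *m B^T by rewrite BD -mulmxA B_orthonormal mulmx1.
  by rewrite !trmx_mul trmxK As mulmxA.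
have AB : A *m B^T = B^T *m D by rewrite -[A in LHS]As -trmx_mul BD trmx_mul D_sym.
by rewrite -mulmxA BD AB mulmxA.
Qed.

Lemma reflection_commP (A : 'M[F]_n) : A^T = A ->
  reflection *m A *m reflection = A <-> stablemx B A.
Proof.
move=> As; rewrite -(stablemx_projectorP As).
have comm_mul : reflection *m A = A *m reflection <-> B^T *m B *m A = A *m B^T *m B.
  rewrite mul_reflection /reflection mulmxBl mul1mx -scalemxAl; split=> [/addrI|->//].
  by move=> /oppr_inj/(scalerI two_neq0).
rewrite -comm_mul; split=> [sAs|->]; last by rewrite -mulmxA reflectionK mulmx1.
by rewrite -{2}sAs -!mulmxA reflectionK mulmx1.
Qed.

End Reflection.

Lemma mulmx_trmx_eq0_sub (F : fieldType) m p q n (A : 'M[F]_(m, n))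
    (B : 'M[F]_(p, n)) (K : 'M[F]_(q, n)) :
  (A <= B)%MS -> K *m B^T = 0 -> K *m A^T = 0.
Proof. by move=> /submxP[D ->] KB; rewrite trmx_mul mulmxA KB mul0mx. Qed.

Lemma diagonalizable_stable_eigenbasis (F : fieldType) (k n : nat)
    (A : 'M[F]_n) (B : 'M[F]_(k, n)) :
  diagonalizable A -> row_free B -> stablemx B A ->
  exists P (d : 'rV[F]_k), (P :=: B)%MS /\ P *m A = diag_mx d *m P.
Proof.
move=> [Q Qu /(similar_diagLR Qu)[a AE]] Bfree BA.
have Qiu : invmx Q \in unitmx by rewrite unitmx_inv.
have Qia : stablemx (invmx Q) (diag_mx a) by rewrite stablemx_unit.
have BQfree : row_free (B *m invmx Q).
  by rewrite /row_free mxrankMfree ?row_free_unit.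
have BQa : stablemx (B *m invmx Q) (diag_mx a) by rewrite stablemx_comp // -AE.
have := diagonalizable_conj_diag BQa BQfree.
rewrite conjMmx -?AE // => -[P Pu /similar_diagPex[d]].
move=> /(similarP Pu) PA; exists (P *m B), d; split.
  by apply: eqmxMfull; rewrite row_full_unit.
by rewrite [RHS]mulmxA -PA -[RHS]mulmxA mulmxKpV // mulmxA.
Qed.

Lemma symmetric_diagonalizable (R : rcfType) n (A : 'M[R]_n) :
  A^T = A -> diagonalizable A.
Proof.
move=> As; pose B := toC A.
have realC m p (X : 'M[R]_(m, p)) : toC X \is a realmx.
  by apply/mxOverP=> i j; rewrite mxE; apply/complex_realP; exists (X i j).
have Bh : B \is hermsymmx.
  apply: realsym_hermsym; last exact: realC.
  by apply/is_hermitianmxP; rewrite expr0 scale1r map_mx_id // map_trmx As.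
have toC_Re m p (X : 'M[R[i]]_(m, p)) : X \is a realmx ->
    X = toC (map_mx (@complex.Re R) X).
  by move=> /mxOverP Xr; apply/matrixP=> i j; rewrite !mxE RRe_real.
pose d := map_mx (@complex.Re R) (spectral_diag B).
have dE : spectral_diag B = toC d by apply/toC_Re/hermitian_spectral_diag_real.
have simB : similar_in unitmx B (toC (diag_mx d)).
  exists (spectralmx B); first exact: spectral_unit.
  apply/similarP; first exact: spectral_unit.
  rewrite map_diag_mx -dE {2}(orthomx_spectralP (hermitian_normalmx Bh)).
  by rewrite !mulmxA mulmxV ?mul1mx ?spectral_unit.
have [Q] := real_similar simB (realC _ _ _) (realC _ _ _).
rewrite inE => /andP[/toC_Re ->]; move: (map_mx _ Q) => P Pu /(similarP Pu).
rewrite -!map_mxM => /map_mx_inj PA; rewrite map_unitmx in Pu.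
exists P => //; apply/similar_diagPex; exists d.
exact/similarP.
Qed.

(** * Quadratic polynomials on Gram matrices of rank at most two *)

Lemma lift0_mxM (F : nzRingType) n (A B : 'M[F]_n) :
  lift0_mx A *m lift0_mx B = lift0_mx (A *m B).
Proof. by rewrite mulmx_block !(mul0mx, mulmx0, mul1mx, addr0, add0r). Qed.

Section FormsInCoordinates.
Variable F : comNzRingType.

Lemma mul_row_col_scalar n (u v : 'I_n -> F) :
  (\row_a u a) *m (\col_a v a) = (\sum_a u a * v a)%:M.
Proof.
by rewrite [LHS]mx11_scalar mxE; congr _%:M; apply: eq_bigr => a _; rewrite !mxE.
Qed.

Lemma mul_row_mx_col_scalar n (Q : 'M[F]_n) (u v : 'I_n -> F) :
  (\row_a u a) *m Q *m (\col_a v a) = (\sum_a \sum_b Q a b * u a * v b)%:M.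
Proof.
rewrite [LHS]mx11_scalar mxE exchange_big; congr _%:M; apply: eq_bigr => b _ /=.
rewrite !mxE mulr_suml; apply: eq_bigr => a _; rewrite mxE.
by rewrite [_ * Q a b]mulrC.
Qed.

Definition quadratic_form p (m : 'rV[F]_p) (Q : 'M[F]_p) (k : 'cV[F]_p) : 'M[F]_1 :=
  m *m k + k^T *m Q *m k.

Lemma bilinear_form_trmx p (Q : 'M[F]_p) (k l : 'cV[F]_p) :
  k^T *m Q *m l = l^T *m Q^T *m k.
Proof.
have tr11 (A : 'M[F]_1) : A^T = A by rewrite [A]mx11_scalar tr_scalar_mx.
by rewrite -[LHS]tr11 !trmx_mul trmxK mulmxA.
Qed.

End FormsInCoordinates.

Lemma quadratic_form_scale_eq0 (F : fieldType) p (c : F) (m : 'rV[F]_p)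
    (Q : 'M[F]_p) (k : 'cV[F]_p) : c != 0 -> c != 1 ->
  quadratic_form m Q k = 0 -> quadratic_form m Q (c *: k) = 0 ->
  m *m k = 0 /\ k^T *m Q *m k = 0.
Proof.
move=> c_neq0 c_neq1 /eqP; rewrite /quadratic_form addr_eq0 => /eqP mk.
rewrite !linearZ /= -!scalemxAl scalerA mk scalerN -scaleNr -scalerDl.
move/eqP; rewrite addrC -[X in _ - X]mulr1 -mulrBr scaler_eq0.
rewrite mulf_eq0 subr_eq0 (negPf c_neq0) (negPf c_neq1) => /eqP->.
by rewrite oppr0.
Qed.

Section RankTwoGramMatrices.
Variables (C : numClosedFieldType) (N : nat).

Lemma linear_rank1_eq0 (V : lmodType C) (f : {linear 'M[C]_N -> V}) :
  (forall x : 'cV[C]_N, f (x *m x^t*) = 0) -> forall G, f G = 0.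
Proof.
move=> f0; pose h (x y : 'cV[C]_N) := f (x *m y^t*).
have hE x y c : c^* *: h x y + c *: h y x = 0.
  have : h (x + c *: y) (x + c *: y) = 0 by exact: f0.
  rewrite /h linearD linearZ /= map_mxD map_mxZ mulmxDl !mulmxDr.
  rewrite -!(scalemxAl, scalemxAr) !linearD /= !linearZ /= !f0 !scaler0.
  by rewrite addr0 add0r.
have h0 x y : h x y = 0.
  have := hE x y 1; have := hE x y 'i; rewrite rmorph1 conjCi !scale1r scaleNr.
  move/eqP; rewrite addrC subr_eq0 => /eqP/(scalerI (neq0Ci C)) ->.
  by move/eqP; rewrite -mulr2n -scaler_nat scaler_eq0 pnatr_eq0 => /eqP.
move=> G; rewrite [G]matrix_sum_delta linear_sum big1 // => i _ /=.
rewrite linear_sum big1 // => j _ /=; rewrite linearZ /= -(mul_delta_mx (0 : 'I_1)).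
have -> : delta_mx 0 j = (delta_mx j 0 : 'cV[C]_N)^t*.
  by rewrite trmx_delta map_delta_mx.
by rewrite -/(h _ _) h0 scaler0.
Qed.

Variables (p : nat) (K : {linear 'M[C]_N -> 'cV[C]_p}).
Hypothesis K_nondegenerate : forall u : 'rV[C]_p, (forall G, u *m K G = 0) -> u = 0.

Lemma mulmx_rank1_eq0 (u : 'rV[C]_p) :
  (forall x : 'cV[C]_N, u *m K (x *m x^t*) = 0) -> u = 0.
Proof. by move=> /(linear_rank1_eq0 (f := mulmx u \o K))/K_nondegenerate. Qed.

(* Scaling [Phi] separates the linear part from the quadratic one; on
   [Phi = (x, y)] the latter polarizes to a form that is bilinear in
   [x x^dagger] and [y y^dagger]. *)
Lemma quadratic_form_rank2_eq0 (m : 'rV[C]_p) (Q : 'M[C]_p) :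
  (forall Phi : 'M[C]_(N, 2), quadratic_form m Q (K (Phi *m Phi^t*)) = 0) ->
  m = 0 /\ Q + Q^T = 0.
Proof.
pose q G := (K G)^T *m Q *m K G; pose null G := m *m K G = 0 /\ q G = 0.
move=> mQ0.
have rank2_0 (Phi : 'M[C]_(N, 2)) : null (Phi *m Phi^t*).
  apply: (@quadratic_form_scale_eq0 _ _ (2%:R * 2%:R)); rewrite -?natrM ?pnatr_eq0 //.
    by rewrite (eqr_nat C 4 1).
  rewrite natrM -linearZ -scalerA; have := mQ0 (2%:R *: Phi).
  by rewrite linearZ /= map_mxZ rmorph_nat -scalemxAl -scalemxAr.
have pair0 (x y : 'cV[C]_N) : null (x *m x^t* + y *m y^t*).
  have -> : x *m x^t* + y *m y^t* = row_mx x y *m (row_mx x y)^t*.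
    by rewrite tr_row_mx map_col_mx mul_row_col.
  exact: rank2_0.
have single0 (x : 'cV[C]_N) : null (x *m x^t*).
  by have := pair0 x 0; rewrite mul0mx addr0.
split; first by apply: mulmx_rank1_eq0 => x; case: (single0 x).
have cross0 (x y : 'cV[C]_N) : (K (x *m x^t*))^T *m (Q + Q^T) *m K (y *m y^t*) = 0.
  have [_] := pair0 x y; have [_] := single0 x; have [_] := single0 y.
  rewrite /q linearD /=; move: (K _) (K _) => k l ll kk.
  rewrite !linearD /= !mulmxDl kk ll add0r addr0.
  by rewrite [l^T *m Q *m k]bilinear_form_trmx addrC.
have left0 (x : 'cV[C]_N) : (Q + Q^T) *m K (x *m x^t*) = 0.
  apply: trmx_inj; rewrite trmx0 trmx_mul.
  apply: mulmx_rank1_eq0 => y; rewrite linearD /= trmxK addrC; exact: cross0.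
apply/row_matrixP=> b; rewrite row0; apply: mulmx_rank1_eq0 => x.
by rewrite -row_mul left0 row0.
Qed.

Lemma quadratic_form_rank2P (m m' : 'rV[C]_p) (Q Q' : 'M[C]_p) :
  (forall Phi : 'M[C]_(N, 2),
     quadratic_form m Q (K (Phi *m Phi^t*)) =
     quadratic_form m' Q' (K (Phi *m Phi^t*)))
  <-> m = m' /\ Q + Q^T = Q' + Q'^T.
Proof.
split=> [eqf|[-> eqQ] Phi].
  have [|/eqP + /eqP] := @quadratic_form_rank2_eq0 (m - m') (Q - Q').
    move=> Phi; rewrite /quadratic_form mulmxBl mulmxBr mulmxBl addrACA -opprD.
    by apply/eqP; rewrite subr_eq0; apply/eqP/eqf.
  rewrite subr_eq0 linearB /= addrACA -opprD subr_eq0.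
  by move=> /eqP-> /eqP->.
congr (_ + _); apply/eqP; rewrite -subr_eq0; apply/eqP.
move: (K _) => k; apply: (@scalerI _ _ 2%:R); rewrite ?pnatr_eq0 //.
rewrite scaler0 -mulmxBl -mulmxBr scaler_nat mulr2n.
rewrite [X in X + _]bilinear_form_trmx -mulmxDl -mulmxDr linearB /= addrACA -opprD.
by rewrite ![_^T + _]addrC eqQ subrr mulmx0 mul0mx.
Qed.

End RankTwoGramMatrices.

(** * Coordinates in a basis of su(N) *)

Section SpecialUnitaryBasis.
Local Open Scope complex_scope.
Variables (R : rcfType) (n N : nat) (lam : 'I_n -> 'M[R[i]]_N).
Local Notation C := R[i].

Definition su_basis : Prop :=
  [/\ n.+1 = (N * N)%N, forall a, (lam a)^t* = lam a, forall a, \tr (lam a) = 0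
    & forall a b, \tr (lam a *m lam b) = (a == b)%:R *+ 2].

Definition su_mx (x : 'rV[R]_n) : 'M[C]_N := \sum_a (x 0 a)%:C *: lam a.

Lemma su_mx_is_linear : linear_for (real_complex R \; *:%R) su_mx.
Proof.
move=> c x y; rewrite /su_mx /= scaler_sumr -big_split; apply: eq_bigr => a _ /=.
by rewrite !mxE rmorphD rmorphM scalerDl scalerA.
Qed.

HB.instance Definition _ :=
  GRing.isLinear.Build R 'rV[R]_n 'M[C]_N (real_complex R \; *:%R) su_mx
    su_mx_is_linear.

Lemma su_mx_delta a : su_mx (delta_mx 0 a) = lam a.
Proof.
rewrite /su_mx (bigD1 a) //= big1 ?addr0 => [|b ab]; rewrite mxE eqxx.
  by rewrite eqxx scale1r.
by rewrite (negPf ab) scale0r.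
Qed.

Definition su_coord (X : 'M[C]_N) : 'rV[R]_n :=
  \row_a complex.Re (\tr (X *m lam a) / 2%:R).

(* The bilinears [K_0] and [K_a], as functions of [G = Phi Phi^dagger]. *)
Definition bilinears (G : 'M[C]_N) : 'cV[C]_(1 + n) :=
  col_mx (\tr G)%:M (\col_a \tr (lam a *m G)).

Lemma bilinears_is_linear : linear bilinears.
Proof.
move=> c G H; rewrite /bilinears scale_col_mx add_col_mx; congr col_mx.
  by rewrite linearP scale_scalar_mx raddfD.
by apply/colP=> a; rewrite !mxE mulmxDr -scalemxAr linearP.
Qed.

HB.instance Definition _ :=
  GRing.isLinear.Build C 'M[C]_N 'cV[C]_(1 + n) *:%R bilinears bilinears_is_linear.

Lemma mul_lift0_bilinears (s : 'M[R]_n) G :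
  toC (lift0_mx s) *m bilinears G =
  col_mx (\tr G)%:M (toC s *m \col_a \tr (lam a *m G)).
Proof.
by rewrite map_block_mx !map_mx0 map_mx1 mul_block_col !mul0mx addr0 add0r mul1mx.
Qed.

Lemma mul_bilinears z (u : 'rV[C]_n) G :
  row_mx z%:M u *m bilinears G = (\tr ((z%:M + \sum_a u 0 a *: lam a) *m G))%:M.
Proof.
rewrite mul_row_col -scalar_mxM mulmxDl mxtraceD mul_scalar_mx mxtraceZ raddfD.
congr (_ + _); rewrite [LHS]mx11_scalar; congr _%:M.
rewrite mxE mulmx_suml raddf_sum.
by apply: eq_bigr => a _; rewrite /= mxE -scalemxAl linearZ.
Qed.

Hypothesis lam_basis : su_basis.

Let lam_tC a : (lam a)^t* = lam a. Proof. by case: lam_basis. Qed.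
Let tr_lam a : \tr (lam a) = 0. Proof. by case: lam_basis. Qed.
Let tr_lam_mul a b : \tr (lam a *m lam b) = (a == b)%:R *+ 2.
Proof. by case: lam_basis. Qed.

Lemma tr_lam_comb z (c : 'I_n -> C) :
  \tr (z%:M + \sum_a c a *: lam a) = z *+ N.
Proof.
rewrite linearD /= mxtrace_scalar raddf_sum big1 ?addr0 // => a _.
by rewrite /= linearZ /= tr_lam mulr0.
Qed.

Lemma tr_lam_comb_mul z (c : 'I_n -> C) b :
  \tr ((z%:M + \sum_a c a *: lam a) *m lam b) = c b *+ 2.
Proof.
rewrite mulmxDl linearD /= mul_scalar_mx linearZ /= tr_lam mulr0 add0r.
rewrite mulmx_suml raddf_sum (bigD1 b) //= big1 ?addr0 => [|a ab].
  by rewrite -scalemxAl linearZ /= tr_lam_mul eqxx mulrnAr mulr1.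
by rewrite -scalemxAl linearZ /= tr_lam_mul (negPf ab) mul0rn mulr0.
Qed.

Let mulrn_dim_eq0 (z : C) : z *+ N = 0 -> z = 0.
Proof.
have [nN _ _ _] := lam_basis => /eqP; rewrite mulrn_eq0.
by case: N nN => [|k] //= _ /eqP.
Qed.

Lemma lam_comb_eq0 z (c : 'I_n -> C) :
  z%:M + \sum_a c a *: lam a = 0 -> z = 0 /\ forall a, c a = 0.
Proof.
move=> zc0; split=> [|a].
  by apply: mulrn_dim_eq0; rewrite -(tr_lam_comb z c) zc0 mxtrace0.
have := tr_lam_comb_mul z c a; rewrite zc0 mul0mx mxtrace0 => /esym/eqP.
by rewrite mulrn_eq0 => /eqP.
Qed.

Lemma lam_comb_surj (X : 'M[C]_N) :
  exists z c, X = z%:M + \sum_a c a *: lam a.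
Proof.
pose B : 'M[C]_(1 + n, N * N) := col_mx (mxvec 1%:M) (\matrix_a mxvec (lam a)).
have BE (u : 'rV[C]_(1 + n)) :
    u *m B = mxvec ((lsubmx u 0 0)%:M + \sum_a rsubmx u 0 a *: lam a).
  rewrite -{1}[u]hsubmxK mul_row_col linearD /=; congr (_ + _).
    by rewrite {1}[lsubmx u]mx11_scalar mul_scalar_mx -linearZ /= scalemx1.
  rewrite mulmx_sum_row linear_sum; apply: eq_bigr => a _ /=.
  by rewrite rowK linearZ.
have Bfree : row_free B.
  apply: inj_row_free => u; rewrite BE => /eqP; rewrite mxvec_eq0 => /eqP.
  case/lam_comb_eq0=> u1 u2; rewrite -[u]hsubmxK [lsubmx u]mx11_scalar u1.
  have -> : rsubmx u = 0 by apply/rowP=> a; rewrite u2 mxE.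
  by rewrite raddf0 row_mx0.
have Bfull : row_full B.
  by have [nN _ _ _] := lam_basis; rewrite /row_full (eqP Bfree) -nN.
have /submxP[u] := submx_full (mxvec X) Bfull.
rewrite BE => /(can_inj mxvecK) ->.
by exists (lsubmx u 0 0), (fun a => rsubmx u 0 a).
Qed.

Lemma bilinears_nondegenerate (u : 'rV[C]_(1 + n)) :
  (forall G, u *m bilinears G = 0) -> u = 0.
Proof.
rewrite -[u]hsubmxK [lsubmx u]mx11_scalar; move: (lsubmx u 0 0) (rsubmx u) => z c u0.
have tr0 G : \tr ((z%:M + \sum_a c 0 a *: lam a) *m G) = 0.
  by have /matrixP/(_ 0 0) := u0 G; rewrite mul_bilinears !mxE mulr1n.
have -> : z = 0.
  by apply: mulrn_dim_eq0; rewrite -(tr_lam_comb z (c 0)) -[_ + _]mulmx1 tr0.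
suff -> : c = 0 by rewrite raddf0 row_mx0.
apply/rowP=> b; rewrite mxE; apply/eqP; have := tr0 (lam b).
by rewrite tr_lam_comb_mul => /eqP; rewrite mulrn_eq0.
Qed.

Lemma trmxC_su_mx x : (su_mx x)^t* = su_mx x.
Proof.
rewrite /su_mx raddf_sum map_mx_sum; apply: eq_bigr => a _ /=.
by rewrite linearZ /= map_mxZ lam_tC; congr (_ *: _); apply: conjc_real.
Qed.

Lemma su_mxK : cancel su_mx su_coord.
Proof.
move=> x; apply/rowP=> a; rewrite mxE.
have := tr_lam_comb_mul 0 (fun b => (x 0 b)%:C) a; rewrite raddf0 add0r => ->.
by rewrite -[_ *+ 2]mulr_natr mulfK // pnatr_eq0.
Qed.

Lemma su_coordK X : X^t* = X -> \tr X = 0 -> su_mx (su_coord X) = X.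
Proof.
move=> Xh trX; have [z [c XE]] := lam_comb_surj X.
have z0 : z = 0 by apply: mulrn_dim_eq0; rewrite -(tr_lam_comb z c) -XE.
have cE a : c a = \tr (X *m lam a) / 2%:R.
  by rewrite XE tr_lam_comb_mul -[_ *+ 2]mulr_natr mulfK // pnatr_eq0.
rewrite [RHS]XE z0 raddf0 add0r; apply: eq_bigr => a _; congr (_ *: _).
rewrite mxE -cE; apply: RRe_real; apply/CrealP.
rewrite cE rmorphM fmorphV rmorph_nat /= -trace_map_mx map_mxM.
by rewrite -mxtrace_tr trmx_mul !map_trmx lam_tC Xh mxtrace_mulC.
Qed.

(* The matrix [R_ab(W)] by which the change of basis [W] rotates the [K_a]. *)
Definition adjoint_mx (W : 'M[C]_N) : 'M[R]_n :=
  \matrix_a su_coord (W^t* *m lam a *m W).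

Lemma adjoint_mxE W a b :
  adjoint_mx W a b = complex.Re (\tr (W^t* *m lam a *m W *m lam b) / 2%:R).
Proof. by rewrite mxE mxE. Qed.

Lemma trmx_adjoint_mx W : (adjoint_mx W)^T = adjoint_mx (W^t*).
Proof.
apply/matrixP=> a b; rewrite mxE [LHS]adjoint_mxE [RHS]adjoint_mxE trmxCK.
by rewrite -mulmxA mxtrace_mulC mulmxA.
Qed.

Section UnitaryConjugation.
Variable W : 'M[C]_N.
Hypothesis W_unitary : W \is unitarymx.

Lemma su_mx_row_adjoint a : su_mx (row a (adjoint_mx W)) = W^t* *m lam a *m W.
Proof.
rewrite rowK su_coordK //; first by rewrite !trmxC_mul trmxCK lam_tC mulmxA.
by rewrite mxtrace_mulC mulmxA (unitarymxP W_unitary) mul1mx.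
Qed.

Lemma su_mx_adjoint x : su_mx (x *m adjoint_mx W) = W^t* *m su_mx x *m W.
Proof.
rewrite mulmx_sum_row linear_sum mulmx_sumr mulmx_suml; apply: eq_bigr => a _ /=.
by rewrite linearZ /= su_mx_row_adjoint -scalemxAr -scalemxAl.
Qed.

Lemma bilinears_conj G :
  bilinears (W *m G *m W^t*) = toC (lift0_mx (adjoint_mx W)) *m bilinears G.
Proof.
rewrite mul_lift0_bilinears; congr col_mx.
  by rewrite mxtrace_mulC mulmxA mul_trmxC_unitary ?mul1mx.
apply/colP=> a; rewrite mxE mulmxA mxtrace_mulC !mulmxA -su_mx_row_adjoint.
rewrite mulmx_suml raddf_sum mxE; apply: eq_bigr => b _.
by rewrite /= -scalemxAl linearZ !mxE.
Qed.

End UnitaryConjugation.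

Lemma adjoint_mx_orthogonal W : W \is unitarymx ->
  adjoint_mx W *m (adjoint_mx W)^T = 1%:M.
Proof.
move=> Wu; apply/row_matrixP=> a; rewrite row_mul row1; apply: (can_inj su_mxK).
rewrite trmx_adjoint_mx su_mx_adjoint ?trmxC_unitary // su_mx_row_adjoint //.
by rewrite trmxCK conj_unitaryKV // su_mx_delta.
Qed.

Section AntisymmetricGenerators.
Variable k : nat.
Hypothesis k_le_n : (k <= n)%N.
Hypothesis trmx_lam : forall a : 'I_n, (lam a)^T = (-1) ^+ (a < k)%N *: lam a.

Let pid : 'M[R]_(k, n) := pid_mx k.

Lemma pid_mx_orthonormal : pid *m pid^T = 1%:M.
Proof. by rewrite tr_pid_mx pid_mx_id // pid_mx_1. Qed.

Lemma reflection_pid_mx : reflection pid = diag_mx (\row_a (-1) ^+ (a < k)%N).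
Proof.
rewrite /reflection tr_pid_mx pid_mx_id //; apply/matrixP=> a b; rewrite !mxE.
have [->|ab] := eqVneq a b.
  by rewrite eqxx /=; case: (b < k)%N; rewrite ?mulr0 ?mulr1 ?subr0 //; ring.
by rewrite (negPf ab : (a == b :> nat) = _) mulr0 subr0.
Qed.

Lemma trmx_su_mx x : (su_mx x)^T = su_mx (x *m reflection pid).
Proof.
rewrite reflection_pid_mx mul_mx_diag raddf_sum; apply: eq_bigr => a _.
by rewrite /= linearZ /= trmx_lam scalerA !mxE rmorphM rmorph_sign.
Qed.

Lemma bilinears_trmx G :
  bilinears G^T = toC (lift0_mx (reflection pid)) *m bilinears G.
Proof.
rewrite mul_lift0_bilinears /bilinears mxtrace_tr; congr col_mx.
rewrite reflection_pid_mx map_diag_mx mul_diag_mx; apply/colP=> a; rewrite !mxE.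
rewrite -mxtrace_tr trmx_mul trmxK mxtrace_mulC trmx_lam -scalemxAl linearZ /=.
by rewrite rmorph_sign.
Qed.

(* Row [a] holds the coordinates of [W (lam a) W^dagger]. *)
Definition so_mx (W : 'M[C]_N) : 'M[R]_(k, n) := pid *m (adjoint_mx W)^T.

Section UnitaryRotation.
Variable W : 'M[C]_N.
Hypothesis W_unitary : W \is unitarymx.

Lemma so_mx_orthonormal : so_mx W *m (so_mx W)^T = 1%:M.
Proof.
rewrite trmx_mul trmxK mulmxA -(mulmxA pid) (mulmx1C (adjoint_mx_orthogonal _)) //.
by rewrite mulmx1 pid_mx_orthonormal.
Qed.

Lemma reflection_so_mx :
  reflection (so_mx W) = adjoint_mx W *m reflection pid *m (adjoint_mx W)^T.
Proof.
rewrite /reflection mulmxBr mulmxBl mulmx1 adjoint_mx_orthogonal //.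
by rewrite -scalemxAr -scalemxAl trmx_mul trmxK !mulmxA.
Qed.

Lemma sub_so_mx x : (x <= so_mx W)%MS <->
  (W^t* *m su_mx x *m W)^T = - (W^t* *m su_mx x *m W).
Proof.
have orth := adjoint_mx_orthogonal W_unitary.
rewrite -su_mx_adjoint // trmx_su_mx -linearN; split.
  move/(reflection_oppP so_mx_orthonormal).
  rewrite reflection_so_mx !mulmxA => /(congr1 (mulmx^~ (adjoint_mx W))) /=.
  by rewrite -[LHS]mulmxA (mulmx1C orth) mulmx1 mulNmx => ->.
move/(can_inj su_mxK) => eqx; apply/(reflection_oppP so_mx_orthonormal).
by rewrite reflection_so_mx !mulmxA eqx -mulmxN -mulmxA mulNmx orth mulmxN mulmx1.
Qed.

Lemma bilinears_CP m (Phi : 'M[C]_(N, m)) (Psi := W *m W^T *m map_mx Num.conj Phi) :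
  bilinears (Psi *m Psi^t*) =
  toC (lift0_mx (reflection (so_mx W))) *m bilinears (Phi *m Phi^t*).
Proof.
have CW := trmxC_unitary W; rewrite W_unitary in CW.
rewrite /Psi gram_CP (bilinears_conj W_unitary) bilinears_trmx.
have := bilinears_conj CW (Phi *m Phi^t*); rewrite trmxCK => ->.
by rewrite -trmx_adjoint_mx !mulmxA -!map_mxM reflection_so_mx !lift0_mxM.
Qed.

End UnitaryRotation.

End AntisymmetricGenerators.

End SpecialUnitaryBasis.

(** * Antisymmetric matrices and eigenvectors *)

Lemma mxtrace_antisym (F : numDomainType) n (Y : 'M[F]_n) : Y^T = - Y -> \tr Y = 0.
Proof.
move=> Ya; apply/eqP; have := mxtrace_tr Y.
by rewrite Ya raddfN /= => /esym/eqP; rewrite -addr_eq0 -mulr2n mulrn_eq0.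
Qed.

Section AntisymmetricMatrices.
Variables (R : realType) (N : nat).
Local Notation C := R[i].

Lemma adjmxE m n (A : 'M[C]_(m, n)) : adjmx A = A^t*.
Proof. by rewrite /adjmx map_trmx. Qed.

Lemma unitarymx_adjmx (U : 'M[C]_N) : U \is unitarymx <-> U *m adjmx U = 1%:M.
Proof. by rewrite adjmxE; split=> [/unitarymxP|/unitarymxP]. Qed.

Lemma i_antisymP (Y : 'M[C]_N) : i_antisym Y <-> Y^t* = Y /\ Y^T = - Y.
Proof.
have mulCI : cI R * cI R = -1 by exact: (sqr_i R).
have conjI : Num.conj (cI R) = - cI R.
  by apply/eqP; rewrite eq_complex /= oppr0 !eqxx.
split=> [[A [At ->]]|[Yh Ya]].
  rewrite -[map_mx _ A]/(toC A).
  have tA : (toC A)^T = - toC A by rewrite map_trmx At map_mxN.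
  have cA : map_mx Num.conj (toC A) = toC A.
    by apply/matrixP=> i j; rewrite !mxE; apply: conjc_real.
  by rewrite linearZ /= tA map_mxZ /= map_mxN cA conjI scaleNr scalerN opprK.
have Yc : map_mx Num.conj Y = - Y.
  by rewrite -Ya -[in RHS]Yh -map_trmx trmxK.
exists (map_mx (@complex.Re R) (- cI R *: Y)).
have ReK : toC (map_mx (@complex.Re R) (- cI R *: Y)) = - cI R *: Y.
  apply/matrixP=> i j; rewrite 2!mxE; apply/RRe_real/CrealP.
  have /matrixP/(_ i j) := Yc; rewrite !mxE rmorphM rmorphN /= conjI => ->.
  by rewrite opprK mulNr mulrN.
split.
  apply: (map_mx_inj (f := real_complex R)).
  by rewrite map_mxN -map_trmx ReK linearZ /= Ya scalerN.
by rewrite -[map_mx _ _ in RHS]/(toC _) ReK scalerA mulrN mulCI opprK scale1r.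
Qed.

Lemma i_antisym_bracket (X Y : 'M[C]_N) : i_antisym X -> i_antisym Y ->
  i_antisym (- cI R *: (X *m Y - Y *m X)).
Proof.
have conjNI : Num.conj (- cI R) = cI R.
  by apply/eqP; rewrite eq_complex /= oppr0 opprK !eqxx.
move=> /i_antisymP[Xh Xa] /i_antisymP[Yh Ya]; apply/i_antisymP.
have brT : (X *m Y - Y *m X)^T = - (X *m Y - Y *m X).
  by rewrite linearB /= !trmx_mul Xa Ya !(mulmxN, mulNmx) !opprK opprB.
have brC : (X *m Y - Y *m X)^t* = - (X *m Y - Y *m X).
  by rewrite linearB /= map_mxB !trmxC_mul Xh Yh opprB.
by rewrite !linearZ /= map_mxZ /= brC brT conjNI !scalerN !scaleNr.
Qed.

End AntisymmetricMatrices.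

Section Eigenvectors.
Variables (R : realType) (k n : nat) (A : 'M[R]_n).
Hypothesis A_symmetric : A^T = A.

Definition rows_of (v : 'I_k -> 'cV[R]_n) : 'M[R]_(k, n) := \matrix_(a, i) v a i 0.

Lemma row_rows_of v a : row a (rows_of v) = (v a)^T.
Proof. by apply/rowP=> i; rewrite !mxE. Qed.

Lemma stablemx_rows_of v : (forall a, eigvec A (v a)) -> stablemx (rows_of v) A.
Proof.
move=> veig; apply/row_subP=> a; have [_ [mu vmu]] := veig a.
rewrite row_mul row_rows_of -{1}A_symmetric -trmx_mul vmu linearZ /=.
by rewrite scalemx_sub // -row_rows_of row_sub.
Qed.

Lemma eigvec_trmx_row (P : 'M[R]_(k, n)) (d : 'rV[R]_k) a :
  row_free P -> P *m A = diag_mx d *m P -> eigvec A (row a P)^T.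
Proof.
move=> Pfree PA; split.
  rewrite trmx_eq0 rowE mulmx_free_eq0 //; apply/eqP => /rowP/(_ a).
  by rewrite !mxE !eqxx => /eqP; rewrite oner_eq0.
exists (d 0 a); rewrite -{1}A_symmetric -trmx_mul -linearZ /= -row_mul PA.
by rewrite row_mul row_diag_mx -scalemxAl -rowE.
Qed.

End Eigenvectors.

(** * CP transformations of the potential *)

Section Potential.
Local Open Scope complex_scope.
Variables (R : realType) (N : nat) (lam : 'I_(ng N) -> 'M[R[i]]_N).
Local Notation C := R[i].

Definition linear_coef M0 (M : 'rV[R]_(ng N)) : 'rV[R]_(1 + ng N) := row_mx M0%:M M.

(* A quadratic form only depends on [Q + Q^T], so that [L] may be put in a
   single off-diagonal block. *)
Definition quadratic_coef Lam0 (L : 'rV[R]_(ng N)) (Lam : 'M[R]_(ng N)) :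
    'M[R]_(1 + ng N) :=
  block_mx Lam0%:M L 0 Lam.

Lemma K0E (Phi : 'M[C]_(N, 2)) : K0 Phi = \tr (Phi *m Phi^t*).
Proof.
apply: eq_bigr => i _; rewrite mxE; apply: eq_bigr => al _.
by rewrite !mxE mulrC.
Qed.

Lemma KbilE (A : 'M[C]_N) (Phi : 'M[C]_(N, 2)) :
  Kbil A Phi = \tr (A *m (Phi *m Phi^t*)).
Proof.
apply: eq_bigr => i _; rewrite mxE; apply: eq_bigr => j _.
rewrite mxE mulr_sumr; apply: eq_bigr => al _.
by rewrite !mxE [_ * A i j]mulrC -mulrA [_ * Phi j al]mulrC.
Qed.

Lemma potentialE M0 Lam0 M L (Lam : 'M[R]_(ng N)) (Phi : 'M[C]_(N, 2)) :
  (potential lam M0 Lam0 M L Lam Phi)%:M =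
  quadratic_form (toC (linear_coef M0 (\row_a M a)))
    (toC (quadratic_coef Lam0 (\row_a L a) Lam))
    (bilinears lam (Phi *m Phi^t*)).
Proof.
rewrite /quadratic_form /linear_coef /quadratic_coef /bilinears.
set G := Phi *m _; pose k a := \tr (lam a *m G).
rewrite map_row_mx map_block_mx map_mx0 !map_scalar_mx tr_col_mx tr_scalar_mx.
have -> : (\col_a k a)^T = \row_a k a by apply/rowP=> a; rewrite !mxE.
have mapE (u : 'I_(ng N) -> R) : toC (\row_a u a) = \row_a (u a)%:C.
  by apply/rowP=> a; rewrite !mxE.
rewrite mul_row_block !mul_row_col mulmx0 addr0 mulmxDl !mapE.
rewrite -!scalar_mxM mul_row_col_scalar mul_row_mx_col_scalar -scalar_mxC.
rewrite mul_mx_scalar -scalemxAl mul_row_col_scalar scale_scalar_mx -!raddfD !addrA.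
have KE a : Kbil (lam a) Phi = k a by exact: KbilE.
rewrite /potential K0E -/G; congr (_ + _ + _ + _ + _)%:M.
- by apply: eq_bigr => a _; rewrite KE.
- by rewrite expr2 mulrCA mulrA.
- by rewrite mulr_sumr; apply: eq_bigr => a _; rewrite KE mulrCA mulrA.
- by do 2!apply: eq_bigr => ? _; rewrite !KE mxE.
Qed.

Hypothesis N_ge2 : (2 <= N)%N.
Hypothesis lam_gell_mann : gell_mann_basis lam.

Lemma gell_mann_su_basis : su_basis lam.
Proof.
have [herm tr0 orth _ _] := lam_gell_mann; split=> // [|a].
  by rewrite /ng -subSn ?subSS ?subn0 ?mulnn // expn_gt0 ltnW.
by rewrite -adjmxE.
Qed.

Lemma trmx_gell_mann a : (lam a)^T = (-1) ^+ (a < nk N)%N *: lam a.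
Proof.
have [herm _ _ im re] := lam_gell_mann.
have -> : (lam a)^T = map_mx (@cconj R) (lam a).
  by rewrite -{1}(herm a) trmxK.
case: ltnP => ak; first by rewrite im // expr1 scaleN1r.
by rewrite re // expr0 scale1r.
Qed.

Lemma nk_le_ng : (nk N <= ng N)%N.
Proof.
case: N N_ge2 => // n _; rewrite /nk /ng [(n.+1 - 1)%N]subn1 /=.
apply: leq_trans (leq_div _ _) _.
by rewrite -mulnn [(n.+1 * n.+1)%N]mulnS addSn subn1 /= leq_addl.
Qed.

Local Notation so W := (so_mx lam (nk N) W).
Local Notation Kvec Phi := (bilinears lam (Phi *m Phi^t*)).

Lemma coef_eqP M0 Lam0 (M M' L L' : 'rV[R]_(ng N)) (Lam Lam' : 'M[R]_(ng N)) :
  Lam^T = Lam -> Lam'^T = Lam' ->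
  (forall Phi : 'M[C]_(N, 2),
     quadratic_form (toC (linear_coef M0 M)) (toC (quadratic_coef Lam0 L Lam))
       (Kvec Phi) =
     quadratic_form (toC (linear_coef M0 M')) (toC (quadratic_coef Lam0 L' Lam'))
       (Kvec Phi))
  <-> [/\ M = M', L = L' & Lam = Lam'].
Proof.
move=> Ls Ls'; have nondeg := bilinears_nondegenerate gell_mann_su_basis.
split=> [/(quadratic_form_rank2P nondeg)[]|[-> -> ->]//].
rewrite !map_trmx -!map_mxD => /map_mx_inj/eq_row_mx[_ ->] /map_mx_inj.
rewrite !tr_block_mx !add_block_mx => /eq_block_mx[_]; rewrite trmx0 !addr0 Ls Ls'.
move=> -> _ /eqP; rewrite -!mulr2n -!scaler_nat.
by rewrite (inj_eq (scalerI _)) ?pnatr_eq0 // => /eqP->.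
Qed.

Lemma potential_CP M0 Lam0 M L Lam (W : 'M[C]_N) (s := reflection (so W)) Phi :
  W \is unitarymx ->
  (potential lam M0 Lam0 M L Lam (W *m W^T *m map_mx (@cconj R) Phi))%:M =
  quadratic_form (toC (linear_coef M0 (\row_a M a *m s)))
    (toC (quadratic_coef Lam0 (\row_a L a *m s) (s *m Lam *m s))) (Kvec Phi).
Proof.
move=> Wu; pose m := linear_coef M0 (\row_a M a).
pose Q := quadratic_coef Lam0 (\row_a L a) Lam; pose S := lift0_mx s.
have -> : linear_coef M0 (\row_a M a *m s) = m *m S.
  by rewrite mul_row_block !mulmx0 mulmx1 addr0 add0r.
have -> : quadratic_coef Lam0 (\row_a L a *m s) (s *m Lam *m s) = S^T *m Q *m S.
  rewrite tr_block_mx !trmx0 trmx1 trmx_reflection.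
  by rewrite !mulmx_block !(mul0mx, mulmx0, mul1mx, mulmx1, addr0, add0r).
rewrite potentialE (bilinears_CP gell_mann_su_basis trmx_gell_mann Wu) -/m -/Q -/S.
by rewrite /quadratic_form !map_mxM [(_ *m bilinears _ _)^T]trmx_mul map_trmx !mulmxA.
Qed.

(* [Phi -> W^dagger Phi] turns the rows of [so W] into the antisymmetric
   generators: all coefficients of the potential are real in that basis. *)
Definition real_in_frame (M L : 'I_(ng N) -> R) (Lam : 'M[R]_(ng N)) (W : 'M[C]_N) :=
  [/\ \row_a M a *m (so W)^T = 0, \row_a L a *m (so W)^T = 0
    & stablemx (so W) Lam].

Lemma so_orthonormal (W : 'M[C]_N) : W \is unitarymx -> so W *m (so W)^T = 1%:M.
Proof. exact: (so_mx_orthonormal gell_mann_su_basis nk_le_ng). Qed.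

Lemma so_row_free (W : 'M[C]_N) : W \is unitarymx -> row_free (so W).
Proof. by move=> Wu; apply/row_freeP; exists (so W)^T; apply: so_orthonormal. Qed.

Lemma CP_invariantP M0 Lam0 M L (Lam : 'M[R]_(ng N)) (W : 'M[C]_N) :
  Lam^T = Lam -> W \is unitarymx ->
  (forall Phi, potential lam M0 Lam0 M L Lam (W *m W^T *m map_mx (@cconj R) Phi) =
               potential lam M0 Lam0 M L Lam Phi) <-> real_in_frame M L Lam W.
Proof.
move=> Ls Wu; pose s := reflection (so W); have orth := so_orthonormal Wu.
have sLs : (s *m Lam *m s)^T = s *m Lam *m s.
  by rewrite !trmx_mul trmx_reflection Ls mulmxA.
have -> : real_in_frame M L Lam W <->
    [/\ \row_a M a *m s = \row_a M a, \row_a L a *m s = \row_a L a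
      & s *m Lam *m s = Lam].
  by split=> -[/(reflection_fixP orth) ? /(reflection_fixP orth) ?
               /(reflection_commP orth Ls) ?].
have scalarI (x y : C) : x%:M = y%:M :> 'M_1 -> x = y.
  by move/matrixP/(_ 0 0); rewrite !mxE.
rewrite -(coef_eqP M0 Lam0 _ _ _ _ sLs Ls); split=> inv Phi.
  by rewrite -potential_CP // inv potentialE.
by apply: scalarI; rewrite potential_CP // inv -potentialE.
Qed.

Lemma has_CP2_frameP M0 Lam0 M L (Lam : 'M[R]_(ng N)) : Lam^T = Lam ->
  has_CP2 lam M0 Lam0 M L Lam <->
  exists2 W, W \is unitarymx & real_in_frame M L Lam W.
Proof.
move=> Ls; split.
  move=> [U [/unitarymx_adjmx Uu U2]].
  have [W Wu ->] := symmetric_unitary_factor Uu ((unitary_conj_mulP Uu).1 U2).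
  by move=> /(CP_invariantP M0 Lam0 M L Ls Wu) ?; exists W.
move=> [W Wu /(CP_invariantP M0 Lam0 M L Ls Wu) inv].
have Uu : W *m W^T \is unitarymx by rewrite mul_unitarymx ?trmx_unitary.
exists (W *m W^T); split=> //; first exact/unitarymx_adjmx.
by apply/(unitary_conj_mulP Uu); rewrite trmx_mul trmxK.
Qed.

(** * Spans that are conjugate to so(N) *)

Lemma VgenE (x : 'cV[R]_(ng N)) : Vgen lam x = su_mx lam x^T.
Proof. by apply: eq_bigr => a _; rewrite mxE. Qed.

Lemma in_WP v X :
  in_W lam v X <-> exists2 x : 'rV[R]_(ng N), X = su_mx lam x & (x <= rows_of v)%MS.
Proof.
have comb (c : 'I_(nk N) -> R) :
    \sum_a (c a)%:C *: Vgen lam (v a) = su_mx lam (\row_a c a *m rows_of v).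
  rewrite mulmx_sum_row linear_sum; apply: eq_bigr => a _ /=.
  by rewrite linearZ /= mxE VgenE row_rows_of.
split=> [[c ->]|[_ -> /submxP[c ->]]].
  by exists (\row_a c a *m rows_of v); rewrite ?submxMl -?comb.
exists (fun a => c 0 a); rewrite comb; congr (su_mx lam (_ *m _)).
by apply/rowP=> a; rewrite mxE.
Qed.

Lemma in_W_su_mx v x : in_W lam v (su_mx lam x) <-> (x <= rows_of v)%MS.
Proof.
split=> [/in_WP[y /(can_inj (su_mxK gell_mann_su_basis)) -> //]|xv].
by apply/in_WP; exists x.
Qed.

Lemma sub_so_i_antisym x (W : 'M[C]_N) : W \is unitarymx ->
  (x <= so W)%MS <-> i_antisym (W^t* *m su_mx lam x *m W).
Proof.
move=> Wu; rewrite i_antisymP; have basis := gell_mann_su_basis.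
rewrite (sub_so_mx basis nk_le_ng trmx_gell_mann Wu); split=> [|[]//].
by split=> //; rewrite !trmxC_mul trmxCK (trmxC_su_mx basis) mulmxA.
Qed.

Lemma i_antisym_conj_su_mx (X W : 'M[C]_N) : W \is unitarymx ->
  i_antisym (W^t* *m X *m W) -> exists x, X = su_mx lam x.
Proof.
move=> Wu; move YE: (_ *m W) => Y /i_antisymP[Yh /mxtrace_antisym Y0].
have XE : X = W *m Y *m W^t* by rewrite -YE conj_unitaryKV.
exists (su_coord lam X); rewrite (su_coordK gell_mann_su_basis) //.
  by rewrite XE !trmxC_mul trmxCK Yh mulmxA.
by rewrite XE mxtrace_mulC mulmxA mul_trmxC_unitary // mul1mx.
Qed.

Lemma in_W_frameP (W : 'M[C]_N) v X : W \is unitarymx -> (rows_of v :=: so W)%MS ->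
  in_W lam v X <-> i_antisym (W^t* *m X *m W).
Proof.
move=> Wu vW; split=> [/in_WP[x ->]|Xa].
  by rewrite vW => /(sub_so_i_antisym _ Wu).
have [x XE] := i_antisym_conj_su_mx Wu Xa; rewrite XE in Xa *.
by apply/in_W_su_mx; rewrite vW; apply/(sub_so_i_antisym _ Wu).
Qed.

Lemma similar_so_frame v (S : 'M[C]_N) : S \in unitmx ->
  (forall X, in_W lam v X -> i_antisym (S *m X *m invmx S)) ->
  (forall Y, i_antisym Y -> exists X, in_W lam v X /\ Y = S *m X *m invmx S) ->
  exists2 W, W \is unitarymx & (rows_of v :=: so W)%MS.
Proof.
move=> Su vS Sv; have [W Wu WS] := unitary_similarity Su.
have Wv X : in_W lam v X -> W *m X *m W^t* = S *m X *m invmx S.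
  move=> vX; have /in_WP[x XE _] := vX; have /i_antisymP[SXh _] := vS X vX.
  by apply: WS => //; rewrite XE trmxC_su_mx //; exact: gell_mann_su_basis.
have Wu' : W^t* \is unitarymx by rewrite trmxC_unitary.
exists (W^t*) => //; apply/eqmxP/rV_eqP=> x; apply/idP/idP.
  move=> /in_W_su_mx vx; apply/(sub_so_i_antisym _ Wu').
  by rewrite trmxCK Wv //; apply: vS.
move=> /(sub_so_i_antisym _ Wu'); rewrite trmxCK => /Sv[X [vX]]; rewrite -Wv //.
by move=> /(conj_unitary_inj Wu) XE; apply/in_W_su_mx; rewrite XE.
Qed.

Lemma cond_iP (Lam : 'M[R]_(ng N)) v :
  cond_i lam Lam v <->
  (forall a, eigvec Lam (v a)) /\
  exists2 W, W \is unitarymx & (rows_of v :=: so W)%MS.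
Proof.
split=> [[_ veig _ [S [Su vS Sv]]]|[veig [W Wu vW]]].
  by split=> //; apply: similar_so_frame Su vS Sv.
have inW := in_W_frameP _ Wu vW; split=> //.
- suff : row_free (rows_of v) by []; rewrite /row_free vW.
  exact: so_row_free Wu.
- move=> X Y /inW Xa /inW Ya; apply/inW; have := i_antisym_bracket Xa Ya.
  by rewrite -scalemxAr -scalemxAl mulmxBr mulmxBl !(conj_unitaryM _ _ Wu).
- have Wu' : W^t* \is unitarymx by rewrite trmxC_unitary.
  exists (W^t*); rewrite unitarymx_unit // invmx_unitary // trmxCK.
  split=> // [X /inW //|Y Ya]; exists (W *m Y *m W^t*).
  by split; [apply/inW; rewrite conj_unitaryK | rewrite conj_unitaryK].
Qed.

Lemma cond_iiP (M L : 'I_(ng N) -> R) v :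
  cond_ii M L v <->
  \row_a M a *m (rows_of v)^T = 0 /\ \row_a L a *m (rows_of v)^T = 0.
Proof.
have rowE (K : 'I_(ng N) -> R) a :
    (\row_i K i *m (rows_of v)^T) 0 a = \sum_i K i * v a i 0.
  by rewrite mxE; apply: eq_bigr => i _; rewrite !mxE.
split=> [LMv|[Mv Lv] a]; last by rewrite -!rowE Mv Lv mxE.
by split; apply/rowP=> a; rewrite rowE mxE; case: (LMv a).
Qed.

Lemma conditions_frameP M L (Lam : 'M[R]_(ng N)) : Lam^T = Lam ->
  (exists v, cond_i lam Lam v /\ cond_ii M L v) <->
  exists2 W, W \is unitarymx & real_in_frame M L Lam W.
Proof.
move=> Ls; split.
  move=> [v [/cond_iP[veig [W Wu vW]] /cond_iiP[Mv Lv]]].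
  exists W => //; split; last by rewrite -(eqmx_stable _ vW) stablemx_rows_of.
    by apply: mulmx_trmx_eq0_sub Mv; rewrite vW.
  by apply: mulmx_trmx_eq0_sub Lv; rewrite vW.
move=> [W Wu [MW LW WLam]].
have [P [d [PW PLam]]] := diagonalizable_stable_eigenbasis
  (symmetric_diagonalizable Ls) (so_row_free Wu) WLam.
have Pfree : row_free P by rewrite /row_free PW; apply: so_row_free Wu.
pose v a := (row a P)^T.
have vE : rows_of v = P by apply/matrixP=> a i; rewrite !mxE.
exists v; rewrite cond_iP cond_iiP vE; split; last first.
  by split; [apply: mulmx_trmx_eq0_sub MW | apply: mulmx_trmx_eq0_sub LW]; rewrite PW.
by split=> [a|]; [apply: eigvec_trmx_row PLam | exists W].
Qed.

End Potential.

Theorem theorem1 (R : realType) (N : nat) (hN : (2 <= N)%N)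
    (lam : 'I_(ng N) -> 'M[R[i]]_N) (hlam : gell_mann_basis lam)
    (M0 Lam0 : R) (M L : 'I_(ng N) -> R) (Lam : 'M[R]_(ng N))
    (hLam : Lam^T = Lam) :
  has_CP2 lam M0 Lam0 M L Lam <->
  exists v : 'I_(nk N) -> 'cV[R]_(ng N), cond_i lam Lam v /\ cond_ii M L v.
Proof. by rewrite conditions_frameP // has_CP2_frameP. Qed.
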